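(* There exist absolute constants $C,C'>0$ such that for all sufficiently large $n$ and every integer $m$ with $n/2\le m\le\binom n2$, a uniformly random graph $G\in\mathcal{G}(n,m)$ satisfies $\Pr[\dim_{\mathrm{TH}}(G)\le C\cdot\frac{2m}{n}\ln n]\ge 1-\frac{C'}{n}$. Equivalently, in the paper's notation, $\Pr[\dim_{\mathrm{TH}}(G)\in O(d_{av}\ln n)]\ge 1-\frac{1}{\Omega(n)}$, where $d_{av}=2m/n$ is the average degree of $G$.
   Context: $\mathcal{G}(n,m)$ denotes the uniform distribution on graphs with vertex set $[n]$ and exactly $m$ edges. A graph $H$ on $N$ vertices is a threshold graph if there exist real numbers $a_1,\dots,a_N,b$ such that the $0$-$1$ solutions of $\sum a_ix_i\le b$ are exactly the characteristic vectors of the cliques of $H$ (equivalently, $H$ has no induced $2K_2$, $P_4$ or $C_4$). The threshold dimension $\dim_{\mathrm{TH}}(G)$ is the smallest $k$ such that there are threshold graphs $G_1,\dots,G_k$ on $V(G)$ with $E(G)=\bigcap_i E(G_i)$. *)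

(* Defs.v *)
From mathcomp Require Import all_boot all_order all_algebra.
From mathcomp Require Import boolp reals exp.

Set Implicit Arguments.
Unset Strict Implicit.
Unset Printing Implicit Defensive.

Import Order.TTheory GRing.Theory Num.Theory.
Local Open Scope ring_scope.

Definition sgraph (T : finType) : Type :=
  {E : {set {set T}} | [forall e in E, #|e| == 2]}.

Definition edges (T : finType) (G : sgraph T) : {set {set T}} := val G.

Definition clique (T : finType) (G : sgraph T) (S : {set T}) : bool :=
  [forall u in S, forall v in S, (u != v) ==> ([set u; v] \in edges G)].

(* A 0-1 vector is a boolean function, read in R through %:R; it is the
   characteristic vector of the set of points where it is true. *)
Definition threshold_graph (R : realType) (T : finType) (G : sgraph T) : Prop :=
  exists (a : T -> R) (b : R), forall x : {ffun T -> bool},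
    \sum_i a i * (x i)%:R <= b <-> clique G [set i | x i].

(* k is required to be positive: the intersection of an empty family is not
   considered, so complete graphs have threshold dimension 1. *)
Definition threshold_cover (R : realType) (T : finType) (G : sgraph T)
    (k : nat) : Prop :=
  (0 < k)%N /\
  exists H : 'I_k -> sgraph T,
    (forall i, threshold_graph R (H i)) /\
    edges G = \bigcap_(i < k) edges (H i).

Lemma compl_edge_subproof (T : finType) (f : {set T}) :
  [forall e in [set e : {set T} | (#|e| == 2) && (e != f)], #|e| == 2].
Proof. by apply/forall_inP => e; rewrite inE => /andP[]. Qed.

(* The complete graph with f removed from its edge set. *)
Definition compl_edge (T : finType) (f : {set T}) : sgraph T :=
  exist (fun E : {set {set T}} => [forall e in E, #|e| == 2])
    _ (compl_edge_subproof f).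

Lemma in_compl_edge (T : finType) (f e : {set T}) :
  (e \in edges (compl_edge f)) = (#|e| == 2) && (e != f).
Proof. by rewrite /edges /= inE. Qed.

Lemma compl_edge_threshold (R : realType) (T : finType) (f : {set T}) :
  (#|f| == 2) || (f == set0) -> threshold_graph R (compl_edge f).
Proof.
move=> hf; exists (fun i => (i \in f)%:R), 1 => x.
set S := [set i | x i].
have -> : \sum_i (i \in f)%:R * (x i)%:R = #|S :&: f|%:R :> R.
  rewrite -sum1_card natr_sum [RHS]big_mkcond /=; apply: eq_bigr => i _.
  by rewrite !inE -natrM; case: (x i); case: (i \in f).
rewrite -[1]/(1%:R) ler_nat; split => [hS|hS].
- apply/forall_inP => u uS; apply/forall_inP => v vS; apply/implyP => uv.
  rewrite in_compl_edge cards2 uv /=; apply/eqP => fE; move: hS; apply/negP.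
  suff -> : S :&: f = [set u; v] by rewrite cards2 uv.
  rewrite -fE; apply/setIidPr/subsetP => w.
  by rewrite in_set2 => /orP[] /eqP ->.
- case/orP: hf => [hf|/eqP ->]; last by rewrite setI0 cards0.
  rewrite leqNgt; apply/negP => h.
  have fS : S :&: f = f.
    by apply/eqP; rewrite eqEcard subsetIr (eqP hf).
  have /cards2P[u [v [uv fE]]] := hf.
  have hin w : w \in f -> w \in S by rewrite -fS => /setIP[].
  have uS : u \in S by apply: hin; rewrite fE !inE eqxx.
  have vS : v \in S by apply: hin; rewrite fE !inE eqxx orbT.
  move: hS => /forall_inP/(_ _ uS)/forall_inP/(_ _ vS)/implyP/(_ uv).
  by rewrite in_compl_edge -fE eqxx andbF.
Qed.

Lemma threshold_cover_ex (R : realType) (T : finType) (G : sgraph T) :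
  exists k, `[< threshold_cover R G k >].
Proof.
exists #|{set T}|; apply/asboolP; split.
  by apply/card_gt0P; exists set0.
pose nonedge (e : {set T}) := (#|e| == 2) && (e \notin edges G).
pose F (e : {set T}) : {set T} := if nonedge e then e else set0.
exists (fun i => compl_edge (F (enum_val i))); split=> [i|].
  apply: compl_edge_threshold; rewrite /F.
  by case: ifP => [/andP[->]|]; rewrite ?eqxx ?orbT.
apply/setP => e; apply/idP/bigcapP => [eG i _|he].
- have e2 : #|e| == 2 by move: (valP G) => /forall_inP; apply.
  rewrite in_compl_edge e2 /F; case: ifP => [/andP[_]|_].
    by apply: contraNneq => <-.
  by apply: contraTneq e2 => ->; rewrite cards0.
- have := he (enum_rank e) isT; rewrite in_compl_edge enum_rankK /F /nonedge.
  by case/andP => ->; case: (e \in edges G) => //=; rewrite eqxx.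
Qed.

Definition dimTH (R : realType) (T : finType) (G : sgraph T) : nat :=
  ex_minn (threshold_cover_ex R G).

Definition gnm (n m : nat) : {set sgraph 'I_n} :=
  [set G : sgraph 'I_n | #|edges G| == m].

Definition prob_gnm (R : realType) (n m : nat) (P : pred (sgraph 'I_n)) : R :=
  #|[set G in gnm n m | P G]|%:R / #|gnm n m|%:R.
Arguments prob_gnm : clear implicits.

(* Main.v *)
Require Import Defs.
From mathcomp Require Import all_boot all_order all_algebra.
From mathcomp Require Import boolp reals sequences exp.
From mathcomp Require Import zify ring lra.

(* With probability at least 1 - 1/n every nonempty vertex set S spans fewer
   than 4D|S| edges, where D = floor(2m/n) + 1: a union bound over S and over
   the 4D|S|-subsets of its pairs, using s^s <= 4^s s!. Such a graph has an
   ordering in which every vertex has at most k = 8D earlier neighbours.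

   Fix such an ordering and a set A of vertices, and let B be the set of
   vertices without an earlier neighbour in A. Deleting from the complete graph
   all pairs u < v with u in A :&: B and v in B gives a threshold graph
   containing G. If A contains each vertex independently with probability
   1/(4k), a given non-edge of G is deleted with probability at least 1/(8k), so
   O(k ln n) sets A suffice to delete every non-edge of G. *)

Import Order.TTheory GRing.Theory Num.Theory.
Local Open Scope ring_scope.

(** * Threshold graphs from a vertex ordering *)

(** At most one element has the top rank [h], contributing [2 ^ h], and by induction the others sum
    to less than [2 ^ h]. *)
Lemma sum_pow2_lt (T : finType) (r : T -> nat) (h : nat) (X : {set T}) :
  {in X &, injective r} -> {in X, forall v, (r v < h)%N} ->
  (\sum_(v in X) 2 ^ r v < 2 ^ h)%N.
Proof.
elim: h X => [|h IH] X rinj rlt.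
  by rewrite big1 // => v /rlt.
have IH' (Y : {set T}) : Y \subset X -> {in Y, forall v, r v != h} ->
    (\sum_(v in Y) 2 ^ r v < 2 ^ h)%N.
  move=> /subsetP YX Yh; apply: IH => [u v uY vY|v vY]; first by apply: rinj; apply: YX.
  by rewrite ltn_neqAle Yh // -ltnS rlt ?YX.
have [/existsP[v /andP[vX /eqP rv]]|] := boolP [exists v, (v \in X) && (r v == h)].
  rewrite (big_setD1 v) //= rv expnS mul2n -addnn ltn_add2l.
  apply: IH' => [|u]; first exact: subsetDl.
  rewrite !inE => /andP[uv uX]; apply: contra_neq uv => ru.
  by apply: rinj => //; rewrite ru.
move=> /existsPn nov; apply: (@ltn_trans (2 ^ h)); last by rewrite ltn_exp2l.
by apply: IH' => // v vX; have := nov v; rewrite vX.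
Qed.

Section OrderedThreshold.
Variables (T : finType) (G : sgraph T) (r : T -> nat).
Implicit Types (A : {set T}).

Definition back_nbrs v : {set T} := [set u | ([set u; v] \in edges G) && (r u < r v)%N].

Definition unblocked A : {set T} := [set v | back_nbrs v :&: A == set0].

(** The pairs to be deleted, oriented by rank; [unblocked A] is the set B of the outline. *)
Definition separated A u v :=
  [&& (r u < r v)%N, u \in A, u \in unblocked A & v \in unblocked A].

Lemma ordered_threshold_subproof A :
  [forall e in [set e : {set T} | (#|e| == 2) &&
     [forall u in e, forall v in e, ~~ separated A u v]], #|e| == 2].
Proof. by apply/forall_inP => e; rewrite inE => /andP[]. Qed.

Definition ordered_threshold A : sgraph T :=
  exist (fun E : {set {set T}} => [forall e in E, #|e| == 2])
    _ (ordered_threshold_subproof A).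

Lemma in_ordered_threshold A u v : u != v ->
  ([set u; v] \in edges (ordered_threshold A)) =
  ~~ separated A u v && ~~ separated A v u.
Proof.
move=> uv; rewrite /edges /= inE cards2 uv /=.
apply/forall_inP/andP => [H|[suv svu] x].
  have uin : u \in [set u; v] by rewrite !inE eqxx.
  have vin : v \in [set u; v] by rewrite !inE eqxx orbT.
  by split; [move/forall_inP: (H _ uin); apply|move/forall_inP: (H _ vin); apply].
rewrite !inE => /orP[]/eqP->; apply/forall_inP => y; rewrite !inE => /orP[]/eqP-> //;
by rewrite /separated ltnn.
Qed.

Lemma edges_card2 e : e \in edges G -> #|e| = 2%N.
Proof. by move: (valP G) => /forall_inP H /H /eqP. Qed.

(** If [u] and [v] were adjacent, [u] would be an earlier neighbour of [v] lying in [A], and [v]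
    would be blocked. *)
Lemma separated_nonedge A u v : separated A u v -> [set u; v] \notin edges G.
Proof.
case/and4P => ruv uA _; rewrite inE => /eqP/setP/(_ u).
by rewrite !inE ruv uA !andbT => ->.
Qed.

Lemma ordered_threshold_super A : edges G \subset edges (ordered_threshold A).
Proof.
apply/subsetP => e eG; have /eqP/cards2P[u [v [uv eE]]] := edges_card2 _ eG.
rewrite eE in_ordered_threshold //; rewrite eE in eG.
apply/andP; split; apply: contraL eG => /separated_nonedge //; by rewrite setUC.
Qed.

(* The bound is 2 ^ n, for n larger than all ranks: a vertex of A fits together
   with all unblocked vertices outside A before it, but with none after it. *)
Definition ordered_weight n A v : nat :=
  if v \in unblocked A then (if v \in A then 2 ^ n - 2 ^ r v else 2 ^ r v)%N else 0%N.

Lemma ordered_thresholdP (R : realType) A : injective r ->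
  threshold_graph R (ordered_threshold A).
Proof.
move=> rinj; pose n := (\max_v r v).+1.
have rn v : (r v < n)%N by rewrite ltnS leq_bigmax.
have pn v : (2 ^ r v < 2 ^ n)%N by rewrite ltn_exp2l.
exists (fun v => (ordered_weight n A v)%:R), (2 ^ n)%:R => x.
set S := [set i | x i].
have -> : \sum_i (ordered_weight n A i)%:R * (x i)%:R =
          (\sum_(i in S) ordered_weight n A i)%:R :> R.
  rewrite natr_sum [RHS]big_mkcond /=; apply: eq_bigr => i _.
  by rewrite inE; case: (x i); rewrite ?mulr1 ?mulr0.
rewrite ler_nat; split=> [le_S|clS].
  apply/forall_inP => u uS; apply/forall_inP => v vS; apply/implyP => uv.
  rewrite in_ordered_threshold //.
  suff H a b : a \in S -> b \in S -> a != b -> ~~ separated A a b.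
    by apply/andP; split; apply: H => //; rewrite eq_sym.
  (* The weight of [a] is [2 ^ n - 2 ^ r a], and that of [b] exceeds [2 ^ r a] whether or not [b]
     lies in [A], so these two alone break the bound. *)
  move=> aS bS ab; apply: contraL le_S => /and4P[rab aA aB bB]; rewrite -ltnNge.
  rewrite (big_setD1 a) //= (big_setD1 b) /=; last by rewrite in_setD1 eq_sym ab.
  rewrite addnA; apply: ltn_addr; rewrite /ordered_weight aA aB bB.
  have lab : (2 ^ r a < 2 ^ r b)%N by rewrite ltn_exp2l.
  have := pn a; have := pn b; case: ifP => _; last by lia.
  have : (2 * 2 ^ r b <= 2 ^ n)%N by rewrite -expnS leq_exp2l.
  lia.
pose X := [set v in S | (v \in unblocked A) && (v \notin A)].
have sumX : (\sum_(v in X) ordered_weight n A v = \sum_(v in X) 2 ^ r v)%N.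
  apply: eq_bigr => v; rewrite inE => /and3P[_ vB vA].
  by rewrite /ordered_weight vB (negPf vA).
have nsep u v : u \in S -> v \in S -> ~~ separated A u v.
  move=> uS vS; have [->|uv] := eqVneq u v; first by rewrite /separated ltnn.
  move: clS => /forall_inP/(_ _ uS)/forall_inP/(_ _ vS)/implyP/(_ uv).
  by rewrite in_ordered_threshold // => /andP[].
(* An unblocked vertex [u] of [A] in the clique comes after all its other unblocked vertices, so
   none of those lies in [A]; together they weigh less than [2 ^ r u]. *)
have [/existsP[u /and3P[uS uA uB]]|] :=
    boolP [exists u, [&& u \in S, u \in A & u \in unblocked A]].
  have lt_u v : v \in S -> v \in unblocked A -> v != u -> (r v < r u)%N.
    move=> vS vB vu; have := nsep u v uS vS.
    rewrite /separated uA uB vB !andbT -leqNgt leq_eqVlt => /orP[/eqP/rinj E|//].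
    by rewrite E eqxx in vu.
  have eqX : (\sum_(i in S) ordered_weight n A i =
              ordered_weight n A u + \sum_(v in X) ordered_weight n A v)%N.
    rewrite (big_setD1 _ uS) /=; congr addn; rewrite big_mkcond [RHS]big_mkcond /=.
    apply: eq_bigr => v _.
    have inS : (v \in S) = x v by rewrite inE.
    rewrite in_setD1 [v \in X]in_set inS /ordered_weight.
    have [->|vu] /= := eqVneq v u; first by rewrite uA !andbF.
    case: (boolP (x v)) => //= xv; case: (boolP (v \in unblocked A)) => //= vB.
    case: (boolP (v \in A)) => //= vA.
    have vS : v \in S by rewrite inS.
    by have := nsep v u vS uS; rewrite /separated lt_u ?vA ?vB ?uB.
  rewrite eqX sumX {1}/ordered_weight uB uA.
  have ltX : {in X, forall v, (r v < r u)%N}.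
    move=> v; rewrite inE => /and3P[vS vB vA]; apply: lt_u => //.
    by apply: contraNneq vA => ->.
  by have := sum_pow2_lt _ _ _ _ (in2W rinj) ltX; have := pn u; lia.
move=> /existsPn noA.
have -> : (\sum_(i in S) ordered_weight n A i = \sum_(v in X) ordered_weight n A v)%N.
  rewrite big_mkcond [RHS]big_mkcond /=; apply: eq_bigr => v _.
  have := noA v; rewrite [v \in X]in_set /ordered_weight.
  by case: (v \in S) => //=; case: (v \in A); case: (v \in unblocked A).
by rewrite sumX; apply/ltnW/sum_pow2_lt => // u v _ _ /rinj.
Qed.

End OrderedThreshold.

(** * Binomial estimates with denominators cleared *)

Lemma leq_expn_fact s : (s ^ s <= 4 ^ s * s`!)%N.
Proof.
(* s ^ s <= (2s)! / s! = 'C(2s, s) s! *)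
have H : ('C(2 * s, s) <= 4 ^ s)%N.
  rewrite (_ : 4 = 2 ^ 2)%N // -expnM.
  rewrite -[X in (_ <= X ^ _)%N]/(1 + 1)%N expnDn.
  have si : (s < (2 * s).+1)%N by lia.
  rewrite (bigD1 (Ordinal si)) //= !exp1n !muln1; exact: leq_addr.
apply: (@leq_trans ('C(2 * s, s) * s`!)); last by rewrite leq_mul2r H orbT.
rewrite bin_ffact ffact_prod -[X in (_ ^ X <= _)%N]card_ord -prod_nat_const.
by apply: leq_prod => i _; have := ltn_ord i; lia.
Qed.

(** This is ['C(n, s) <= (4 n / s) ^ s], with 4 in place of the usual constant e. *)
Lemma leq_bin_expn n s : ('C(n, s) * s ^ s <= (4 * n) ^ s)%N.
Proof.
rewrite expnMn; apply: (@leq_trans ('C(n, s) * (4 ^ s * s`!))).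
  by rewrite leq_mul2l leq_expn_fact orbT.
rewrite mulnCA leq_mul2l; apply/orP; right; rewrite bin_ffact ffact_prod.
rewrite -[X in (_ <= _ ^ X)%N]card_ord -prod_nat_const.
by apply: leq_prod => i _; exact: leq_subr.
Qed.

(** Factor by factor, [(m - i) / (N - i) <= m / N] because [m <= N]. *)
Lemma leq_ffact_expn N m L : (m <= N)%N -> (m ^_ L * N ^ L <= N ^_ L * m ^ L)%N.
Proof.
move=> mN; elim: L => [|L IH]; first by rewrite !ffactn0 !expn0.
rewrite !ffactnSr !expnSr.
rewrite (_ : _ * (m - L) * _ = (m ^_ L * N ^ L) * ((m - L) * N))%N; last by lia.
rewrite (_ : _ * (N - L) * _ = (N ^_ L * m ^ L) * ((N - L) * m))%N; last by lia.
apply: leq_mul => //; rewrite !mulnBl; nia.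
Qed.

(** With [N = #|U|] and [L = #|F|], a uniform [m]-subset of [U] contains [F] with probability at
    most [(m / N) ^ L]: removing [F] is injective on such sets, and ['C(N - L, m - L) / 'C(N, m) = m
    ^_ L / N ^_ L]. *)
Lemma card_supersets (T : finType) (U F : {set T}) m : F \subset U ->
  (m <= #|U|)%N ->
  (#|[set E : {set T} | [&& E \subset U, #|E| == m & F \subset E]]| * #|U| ^ #|F|
   <= 'C(#|U|, m) * m ^ #|F|)%N.
Proof.
move=> FU mU; set X := [set _ | _]; set L := #|F|; set N := #|U|.
have LN : (L <= N)%N by apply: subset_leq_card.
have [Lm|mL] := leqP L m; last first.
  suff -> : X = set0 by rewrite cards0.
  apply/setP => E; rewrite !inE; apply/negP => /and3P[_ /eqP Em /subset_leq_card].
  by rewrite Em leqNgt mL.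
have cX : (#|X| <= 'C(N - L, m - L))%N.
  have <- : #|U :\: F| = (N - L)%N by rewrite cardsD (setIidPr FU).
  rewrite -cards_draws.
  rewrite -(@card_in_imset _ _ (fun E => E :\: F) X); last first.
    move=> E1 E2; rewrite !inE => /and3P[_ _ F1] /and3P[_ _ F2] E12.
    by rewrite -(setID E1 F) -(setID E2 F) E12 (setIidPr F1) (setIidPr F2).
  apply/subset_leq_card/subsetP => D /imsetP[E EX ->]; move: EX.
  rewrite [E \in X]in_set => /and3P[EU /eqP Em FE].
  by rewrite inE setSD //= cardsD (setIidPr FE) Em.
have id : ('C(N - L, m - L) * N ^_ L = 'C(N, m) * m ^_ L)%N.
  have f0 : (0 < (m - L)`! * (N - m)`!)%N by rewrite muln_gt0 !fact_gt0.
  apply/eqP; rewrite -(eqn_pmul2r f0); apply/eqP.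
  have h1 := @bin_fact (N - L) (m - L) ltac:(lia).
  have h2 := @bin_fact N m mU.
  have h3 := ffact_fact LN. have h4 := ffact_fact Lm.
  rewrite (_ : N - L - (m - L) = N - m)%N in h1; last by lia.
  transitivity (N`!); first by rewrite -h3 -h1; ring.
  by rewrite -h2 -h4; ring.
have Np : (0 < N ^_ L)%N by rewrite ffact_gt0.
rewrite -(leq_pmul2r Np); apply: (@leq_trans ('C(N, m) * (m ^_ L * N ^ L))).
  by rewrite mulnA -id -!mulnA [(N ^ L * _)%N]mulnC leq_mul2r cX orbT.
by rewrite -mulnA leq_mul2l [X in (_ <= X)%N]mulnC leq_ffact_expn ?orbT.
Qed.

(** * Covering the non-edges by random sets *)

Lemma bernoulli (R : realDomainType) (x : R) n : 0 <= x <= 1 ->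
  1 - n%:R * x <= (1 - x) ^+ n.
Proof.
case/andP => x0 x1; elim: n => [|n IH]; first by rewrite mul0r subr0 expr0.
have n0 : 0 <= n%:R :> R by [].
rewrite exprS; apply: (@le_trans _ _ ((1 - x) * (1 - n%:R * x))).
  rewrite -natr1; nra.
by apply: ler_wpM2l => //; lra.
Qed.

(** Counting functions models a random set: with [Q = q + 1], the zeros of a uniform [f] contain
    each point independently with probability [1 / Q]. The event has probability
    [(1 / Q) (1 - 1 / Q) ^ #|N|], whose second factor is at least 1/2 by Bernoulli's inequality. *)
Lemma card_ffun_zero_avoiding (R : realFieldType) (T : finType) (q : nat)
    (u : T) (N : {set T}) : u \notin N -> (2 * #|N| <= q.+1)%N ->
  (2 * q.+1%:R)^-1 * #|{ffun T -> 'I_q.+1}|%:R <=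
  #|[set f : {ffun T -> 'I_q.+1} |
      (f u == ord0) && [forall w in N, f w != ord0]]|%:R :> R.
Proof.
move=> uN Nq.
pose F v : pred 'I_q.+1 := if v == u then pred1 ord0
  else if v \in N then predC1 ord0 else predT.
have -> : #|[set f : {ffun T -> 'I_q.+1} |
      (f u == ord0) && [forall w in N, f w != ord0]]| = #|family F|.
  apply: eq_card => f; rewrite inE; apply/andP/familyP => [[fu /forall_inP fN] v|H].
    rewrite /F; have [->|vu] := eqVneq v u; first by rewrite unfold_in.
    by case: ifP => [/fN|//].
  split; first by have := H u; rewrite /F eqxx.
  apply/forall_inP => w wN; have := H w; rewrite /F wN.
  by case: eqVneq => [wu|//]; rewrite -wu wN in uN.
rewrite card_family card_ffun card_ord.
set Q : R := q.+1%:R; have Q0 : 0 < Q by rewrite ltr0n.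
have cF v : #|F v|%:R = Q * (if v == u then Q^-1 else if v \in N then 1 - Q^-1 else 1).
  rewrite /F; case: ifP => _; first by rewrite card1 mulfV // gt_eqF.
  case: ifP => _; last by rewrite cardT size_enum_ord mulr1.
  have := cardC1 (@ord0 q); rewrite card_ord /= => ->.
  by rewrite mulrBr mulr1 mulfV ?gt_eqF // /Q -natr1 addrK.
have -> : (foldr muln 1 [seq #|F x| | x : T])%:R =
    Q ^+ #|T| * (Q^-1 * (1 - Q^-1) ^+ #|N|) :> R.
  rewrite foldrE big_map big_enum natr_prod /= (eq_bigr _ (fun v _ => cF v)).
  rewrite big_split /= prodr_const; congr (_ * _).
  rewrite (bigD1 u) //= eqxx; congr (_ * _).
  rewrite -prodr_const big_mkcond [RHS]big_mkcond /=; apply: eq_bigr => v _.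
  by case: eqVneq => // ->; rewrite (negPf uN).
rewrite natrX mulrC; apply: ler_wpM2l; first by apply: exprn_ge0; apply: ltW.
rewrite invfM mulrC; apply: ler_wpM2l; first by rewrite invr_ge0 ltW.
apply: le_trans (bernoulli _ _ _ _); last first.
  by rewrite invr_ge0 ltW //= invf_le1 // ler1n.
have : 2 * #|N|%:R <= Q by rewrite -natrM ler_nat.
move=> h; have h2 : #|N|%:R * Q^-1 <= 2^-1 by rewrite ler_pdivrMr //; lra.
move: h2; set x := _ / _ => h2; lra.
Qed.

(* Averaging gives one y covering a fraction d of what is still uncovered; iterate. *)
Lemma greedy_cover (R : realFieldType) (X Y : finType) (cov : X -> Y -> bool)
    (P : {set X}) (d : R) : d <= 1 -> (0 < #|Y|)%N ->
  (forall x, x \in P -> d * #|Y|%:R <= #|[set y | cov x y]|%:R) ->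
  forall t, exists c : 'I_t -> Y,
    #|[set x in P | [forall i, ~~ cov x (c i)]]|%:R <= (1 - d) ^+ t * #|P|%:R.
Proof.
move=> d1 Y0 Hd; elim=> [|t [c IH]].
  have /card_gt0P[y0 _] := Y0; exists (fun _ => y0).
  rewrite expr0 mul1r ler_nat; apply/subset_leq_card/subsetP => x.
  by rewrite inE => /andP[].
set U := [set _ | _] in IH.
have [y hy] : exists y, d * #|U|%:R <= #|[set x in U | cov x y]|%:R.
  apply/existsP; apply: contraT => /existsPn H.
  have lt : \sum_y #|[set x in U | cov x y]|%:R < (d * #|U|%:R) *+ #|Y|.
    have /card_gt0P[y0 _] := Y0; rewrite -sumr_const.
    apply: ltr_sum => [|y _]; last by rewrite ltNge H.
    by apply/hasP; exists y0; rewrite ?mem_index_enum.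
  have : (d * #|Y|%:R) *+ #|U| <= \sum_(x in U) (#|[set y | cov x y]|%:R : R).
    by rewrite -sumr_const; apply: ler_sum => x; rewrite inE => /andP[xP _]; apply: Hd.
  have -> : \sum_(x in U) (#|[set y | cov x y]|%:R : R) =
            \sum_y #|[set x in U | cov x y]|%:R.
    rewrite (eq_bigr (fun x => \sum_(y | cov x y) 1)); last first.
      by move=> x _; rewrite -sum1_card natr_sum; apply: eq_bigl => y; rewrite inE.
    rewrite (exchange_big_dep predT) //=; apply: eq_bigr => y _.
    by rewrite -sum1_card natr_sum; apply: eq_bigl => x; rewrite [in RHS]in_set.
  move=> le; have := le_lt_trans le lt.
  by rewrite -[X in X < _]mulr_natr -[X in _ < X]mulr_natr mulrAC ltxx.
exists (fun i => if unlift ord0 i is Some j then c j else y).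
have le : #|[set x in P |
      [forall i, ~~ cov x (if unlift ord0 i is Some j then c j else y)]]|%:R <=
    #|U :\: [set x in U | cov x y]|%:R :> R.
  rewrite ler_nat; apply/subset_leq_card/subsetP => x.
  rewrite [x \in _]in_set => /andP[xP /forallP H].
  have xy : ~~ cov x y by have := H ord0; rewrite unlift_none.
  rewrite in_setD [x \in [set _ in U | _]]in_set (negPf xy) andbF /= in_set xP /=.
  by apply/forallP => i; have := H (lift ord0 i); rewrite liftK.
apply: le_trans le _.
have sU : [set x in U | cov x y] \subset U by apply/subsetP => x; rewrite in_set => /andP[].
rewrite cardsD (setIidPr sU) natrB ?subset_leq_card // exprS -mulrA.
apply: (@le_trans _ _ ((1 - d) * #|U|%:R)); first by lra.
by apply: ler_wpM2l => //; lra.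
Qed.

Lemma dimTH_le (R : realType) (T : finType) (G : sgraph T) k :
  threshold_cover R G k -> (dimTH R G <= k)%N.
Proof. by rewrite /dimTH; case: ex_minnP => t _ H /asboolP; apply: H. Qed.

(** Greedy covering leaves fewer than one non-edge, hence none, after [t] sets; each set gives one
    threshold graph. *)
Lemma dimTH_le_cover (R : realType) (T : finType) (G : sgraph T) (r : T -> nat)
    (k t : nat) : (0 < k)%N -> injective r ->
  (forall v, #|back_nbrs T G r v| <= k)%N ->
  (1 - (8 * k%:R)^-1) ^+ t * (#|T| ^ 2)%:R < 1 :> R ->
  (dimTH R G <= t.+1)%N.
Proof.
move=> k0 rinj rk ht.
(* Zeros have probability [1 / (4 k)]: [u] and [v] together have at most [2 k] earlier neighbours,
   half of [q.+1], which gives the density [1 / (8 k)]. *)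
pose q := (4 * k).-1; have q4 : (q.+1 = 4 * k)%N by rewrite prednK // muln_gt0.
pose zeros (f : {ffun T -> 'I_q.+1}) : {set T} := [set v | f v == ord0].
pose P : {set T * T} := [set p | (r p.1 < r p.2)%N && ([set p.1; p.2] \notin edges G)].
pose cov (p : T * T) f := separated T G r (zeros f) p.1 p.2.
have d1 : (8 * k%:R)^-1 <= 1 :> R.
  by rewrite invf_le1 ?mulr_gt0 ?ltr0n // -natrM ler1n; lia.
have [||c Hc] := @greedy_cover R _ _ cov P (8 * k%:R)^-1 d1 _ _ t.
- by apply/card_gt0P; exists [ffun=> ord0].
- move=> [u v]; rewrite inE /= => /andP[ruv nuv].
  (* The pair is separated as soon as [u] is chosen and no vertex of [N] is. *)
  pose N := back_nbrs T G r u :|: back_nbrs T G r v.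
  have uN : u \notin N by rewrite !inE ltnn andbF (negPf nuv).
  have cN : (2 * #|N| <= q.+1)%N.
    have : (#|N| <= #|back_nbrs T G r u| + #|back_nbrs T G r v|)%N by apply: leq_card_setU.
    by rewrite q4; have := rk u; have := rk v; lia.
  have := card_ffun_zero_avoiding R T q u N uN cN.
  have -> : 2 * q.+1%:R = 8 * k%:R :> R by rewrite q4 natrM mulrA -natrM.
  move=> H; apply: le_trans H _.
  rewrite ler_nat; apply/subset_leq_card/subsetP => f.
  rewrite !in_set => /andP[fu /forall_inP fN].
  rewrite /cov /separated ruv !in_set fu /=.
  by apply/andP; split; apply/eqP/setP => w; rewrite in_setI [w \in zeros _]in_set in_set0;
    apply/negP => /andP[wN]; apply/negP/fN; rewrite in_setU wN ?orbT.
set U := [set _ | _] in Hc.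
have U0 : U = set0.
  apply/eqP; rewrite -cards_eq0 -leqn0 -ltnS -(ltr_nat R).
  apply: le_lt_trans Hc (le_lt_trans _ ht); apply: ler_wpM2l.
    by apply: exprn_ge0; lra.
  by rewrite ler_nat -mulnn -card_prod max_card.
apply: dimTH_le; split=> //.
(* The extra index [ord0] carries the empty set, whose graph is complete: the family is nonempty
   even for [t = 0], and a common member [e] is seen to have two elements. *)
pose A (i : 'I_t.+1) := if unlift ord0 i is Some j then zeros (c j) else set0.
exists (fun i => ordered_threshold T G r (A i)).
split=> [i|]; first exact: ordered_thresholdP.
apply/setP => e; apply/idP/bigcapP => [eG i _|H].
  by have /subsetP := ordered_threshold_super T G r (A i); apply.
have : #|e| == 2.
  by have := H ord0 isT; rewrite /edges /= inE => /andP[].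
case/cards2P => u [v [uv eE]].
wlog ruv : u v uv eE / (r u < r v)%N => [W|].
  have := uv; rewrite -(inj_eq rinj) neq_ltn => /orP[] ruv; first exact: (W u v).
  by apply: (W v u) => //; rewrite 1?eq_sym // setUC.
apply: contraT => eG.
have : (u, v) \notin U by rewrite U0 inE.
rewrite inE inE /= ruv -eE eG /= => /forallPn[i]; rewrite negbK => sep.
have := H (lift ord0 i) isT; rewrite /A liftK eE in_ordered_threshold //.
by case/andP => /negP; case.
Qed.

(** * Degenerate orderings of sparse graphs *)

Definition edges_in (T : finType) (G : sgraph T) (S : {set T}) : {set {set T}} :=
  [set e in edges G | e \subset S].

Definition nbrs_in (T : finType) (G : sgraph T) (S : {set T}) v : {set T} :=
  [set u in S | [set u; v] \in edges G].

(** Double counting of the incidences between vertices of [S] and edges inside [S]; each edge has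
    two ends. *)
Lemma sum_card_nbrs_in (T : finType) (G : sgraph T) (S : {set T}) :
  (\sum_(v in S) #|nbrs_in T G S v| <= 2 * #|edges_in T G S|)%N.
Proof.
have le v : v \in S ->
    (#|nbrs_in T G S v| <= \sum_(e in edges_in T G S | v \in e) 1)%N.
  move=> vS; rewrite -(@card_in_imset _ _ (fun u => [set u; v])); last first.
    move=> a b; rewrite !inE => /andP[_ aE] /andP[_ bE] E.
    have := edges_card2 T G _ aE; rewrite cards2; case: eqVneq => // av _.
    have : a \in [set b; v] by rewrite -E !inE eqxx.
    by rewrite !inE (negPf av) orbF => /eqP.
  rewrite sum1_card; apply/subset_leq_card/subsetP => e /imsetP[u].
  rewrite inE => /andP[uS uE] ->; rewrite unfold_in /= !inE uE eqxx orbT andbT /=.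
  by apply/subsetP => w; rewrite !inE => /orP[]/eqP->.
have le_sum : (\sum_(v in S) #|nbrs_in T G S v| <=
    \sum_(v in S) \sum_(e in edges_in T G S | v \in e) 1)%N by apply: leq_sum.
apply: leq_trans le_sum _.
rewrite (exchange_big_dep (mem (edges_in T G S))) /=; last by move=> v e _ /andP[].
rewrite mulnC -sum_nat_const; apply: leq_sum => e; rewrite inE => /andP[eE eS].
rewrite -(edges_card2 T G e eE) -sum1_card big_mkcond [X in (_ <= X)%N]big_mkcond /=.
apply: leq_sum => v _; case: (v \in e); rewrite ?andbF //; by case: ifP.
Qed.

(** Ranks are assigned from the top: a vertex with few neighbours in the current set is placed last,
    and the rest is ordered by induction. *)
Lemma degenerate_order (T : finType) (G : sgraph T) k :
  (forall S : {set T}, S != set0 -> exists2 v, v \in S & (#|nbrs_in T G S v| <= k)%N) ->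
  exists2 r : T -> nat, injective r & forall v, (#|back_nbrs T G r v| <= k)%N.
Proof.
move=> deg.
(* The induction runs over all vertex sets [S], with ranks below [#|S|] so that a vertex added to
   [S] can take the rank [#|S|]. *)
suff [r rinj [_ rk]] : exists2 r : T -> nat, {in [set: T] &, injective r} &
    {in [set: T], forall v, (r v < #|[set: T]|)%N} /\
    {in [set: T], forall v, (#|[set u in [set: T] | u \in back_nbrs T G r v]| <= k)%N}.
  exists r => [u v|v]; first by apply: rinj; rewrite inE.
  have := rk v (in_setT _); congr (_ <= _)%N; apply: eq_card => u.
  by rewrite in_set in_setT.
move: [set: T] => S; move sS: #|S| => s.
elim: s S sS => [|s IH] S sS.
  by exists (fun _ => 0%N) => [u v|]; rewrite (cards0_eq sS) ?inE //; split=> u; rewrite inE.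
have [|v vS vk] := deg S; first by rewrite -card_gt0 sS.
have sS' : #|S :\ v| = s by have := cardsD1 v S; rewrite vS sS => -[].
have [r rinj [rlt rk]] := IH _ sS'.
pose r' u := if u == v then s else r u.
have r'E u : u \in S -> u != v -> (r' u < s)%N.
  by move=> uS uv; rewrite /r' (negPf uv) rlt // !inE uv.
exists r' => [a b aS bS|].
  have [av|av] := eqVneq a v; have [bv|bv] := eqVneq b v; first by rewrite av bv.
  - by move=> E; have := r'E b bS bv; rewrite -E /r' av eqxx ltnn.
  - by move=> E; have := r'E a aS av; rewrite E /r' bv eqxx ltnn.
  by rewrite /r' (negPf av) (negPf bv); apply: rinj; rewrite !inE ?av ?bv.
split=> [u uS|w wS].
  by have [->|uv] := eqVneq u v; [rewrite /r' eqxx | apply/ltnW/r'E].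
have [wv|wv] := eqVneq w v.
  apply: leq_trans vk; apply/subset_leq_card/subsetP => u; rewrite wv.
  by rewrite !in_set => /andP[-> /andP[->]].
have wS' : w \in S :\ v by rewrite !inE wv.
apply: leq_trans (rk w wS'); apply/subset_leq_card/subsetP => u.
rewrite !in_set => /and3P[uS uw]; have [->|uv] := eqVneq u v.
  by move=> lt; have := r'E w wS wv; rewrite ltnNge ltnW // -[s](_ : r' v = s) // /r' eqxx.
by rewrite uS uw /r' (negPf uv) (negPf wv) in_set1 uv.
Qed.

(** The degrees within [S] average less than [8 D], so some vertex of [S] has at most that many
    neighbours there. *)
Lemma sparse_degenerate (T : finType) (G : sgraph T) D :
  (forall S : {set T}, S != set0 -> (#|edges_in T G S| < 4 * D * #|S|)%N) ->
  exists2 r : T -> nat, injective r & forall v, (#|back_nbrs T G r v| <= 8 * D)%N.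
Proof.
move=> sp; apply: degenerate_order => S S0.
apply/exists_inP; apply: contraT => /exists_inPn H.
have : (\sum_(v in S) (8 * D) <= \sum_(v in S) #|nbrs_in T G S v|)%N.
  by apply: leq_sum => v vS; have := H v vS; rewrite -ltnNge; apply: ltnW.
rewrite sum_nat_const; have := sum_card_nbrs_in T G S; have := sp S S0; lia.
Qed.

(** * Counting graphs with a dense vertex set *)

Definition all_pairs (T : finType) (S : {set T}) : {set {set T}} :=
  [set e : {set T} | e \subset S & #|e| == 2].

Lemma card_edges_imset n (X : {set sgraph 'I_n}) : #|X| = #|(fun G => edges G) @: X|.
Proof. by rewrite card_imset //; apply: val_inj. Qed.

Lemma edges_gnmP n m (E : {set {set 'I_n}}) :
  reflect (exists2 G, G \in gnm n m & edges G = E)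
          ((E \subset all_pairs _ [set: 'I_n]) && (#|E| == m)).
Proof.
apply: (iffP andP) => [[/subsetP E2 Em]|[G Gm <-]].
  have EP : [forall e in E, #|e| == 2].
    by apply/forall_inP => e /E2; rewrite inE => /andP[].
  exists (exist (fun E : {set {set 'I_n}} => [forall e in E, #|e| == 2]) E EP) => //.
  by rewrite inE.
split; last by rewrite inE in Gm.
by apply/subsetP => e eG; rewrite inE subsetT (edges_card2 _ _ _ eG).
Qed.

Lemma card_gnm n m : #|gnm n m| = 'C('C(n, 2), m).
Proof.
have cU : #|all_pairs _ [set: 'I_n]| = 'C(n, 2) by rewrite cards_draws cardsT card_ord.
rewrite card_edges_imset -cU -cards_draws; apply: eq_card => E.
rewrite [in RHS]inE; apply/imsetP/edges_gnmP => [[G Gm ->]|[G Gm <-]]; by exists G.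
Qed.

Lemma card_gnm_super n m (F : {set {set 'I_n}}) : F \subset all_pairs _ [set: 'I_n] ->
  (m <= 'C(n, 2))%N ->
  (#|[set G in gnm n m | F \subset edges G]| * 'C(n, 2) ^ #|F| <= #|gnm n m| * m ^ #|F|)%N.
Proof.
have cU : #|all_pairs _ [set: 'I_n]| = 'C(n, 2) by rewrite cards_draws cardsT card_ord.
move=> FU mN; rewrite card_gnm card_edges_imset -{1 2}cU.
apply: leq_trans (card_supersets _ _ _ m FU _); last by rewrite cU.
rewrite leq_mul2r; apply/orP; right; apply/subset_leq_card/subsetP => E /imsetP[G].
rewrite inE => /andP[Gm FG] ->; rewrite in_set.
have /andP[-> ->] : (edges G \subset all_pairs _ [set: 'I_n]) && (#|edges G| == m).
  by apply/edges_gnmP; exists G.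
by [].
Qed.

Lemma leq_card_bigcup (I T : finType) (P : pred I) (B : I -> {set T}) :
  (#|\bigcup_(i | P i) B i| <= \sum_(i | P i) #|B i|)%N.
Proof.
elim/big_rec2: _ => [|i s A _ IH]; first by rewrite cards0.
by apply: leq_trans (leq_card_setU _ _) _; rewrite leq_add2l.
Qed.

(** Union bound over the [L]-sets [F] of pairs inside [S], each contained in the random edge set
    with probability at most [(m / 'C(n, 2)) ^ L]. *)
Lemma card_gnm_dense n m (S : {set 'I_n}) L : (m <= 'C(n, 2))%N ->
  (#|[set G in gnm n m | L <= #|edges_in _ G S|]| * 'C(n, 2) ^ L
    <= 'C('C(#|S|, 2), L) * (#|gnm n m| * m ^ L))%N.
Proof.
move=> mN; pose FS := [set F : {set {set 'I_n}} | F \subset all_pairs _ S & #|F| == L].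
have -> : 'C('C(#|S|, 2), L) = #|FS| by rewrite cards_draws cards_draws.
pose B (F : {set {set 'I_n}}) := [set G in gnm n m | F \subset edges G].
have le : (#|[set G in gnm n m | (L <= #|edges_in _ G S|)%N]| <= \sum_(F in FS) #|B F|)%N.
  apply: leq_trans (_ : #|\bigcup_(F in FS) B F| <= _)%N; last first.
    exact: leq_card_bigcup.
  apply/subset_leq_card/subsetP => G; rewrite inE => /andP[Gm GL].
  have [F /andP[FE FL]] : exists F : {set {set 'I_n}}, (F \subset edges_in _ G S) && (#|F| == L).
    have : (0 < #|[set F : {set {set 'I_n}} | F \subset edges_in _ G S & #|F| == L]|)%N.
      by rewrite cards_draws bin_gt0.
    by case/card_gt0P => F; rewrite inE; exists F.
  apply/bigcupP; exists F; rewrite inE ?Gm ?FL ?andbT /=.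
    apply: subset_trans FE _; apply/subsetP => e; rewrite !inE => /andP[eG ->].
    by rewrite (edges_card2 _ _ _ eG).
  by apply: subset_trans FE _; apply/subsetP => e; rewrite inE => /andP[].
apply: leq_trans (leq_mul le (leqnn _)) _.
rewrite big_distrl /= -sum_nat_const; apply: leq_sum => F.
rewrite inE => /andP[FS' /eqP <-]; apply: card_gnm_super => //.
apply: subset_trans FS' _; apply/subsetP => e; rewrite !inE => /andP[_ ->].
by rewrite subsetT.
Qed.

Lemma mul2_bin2 n : (2 * 'C(n, 2) = n * n.-1)%N.
Proof. by case: n => [//|n]; rewrite -mul_bin_diag bin1. Qed.

(** The factor ['C(n, #|S|)] pays for the choice of [S] among the sets of its size and [2 ^ #|S|]
    for the sum over sizes, which leaves [1 / n] in the union bound. *)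
Lemma card_gnm_dense_le n m D (S : {set 'I_n}) :
  (1 < n)%N -> (0 < D)%N -> (2 * m <= D * n)%N -> (m <= 'C(n, 2))%N -> S != set0 ->
  ('C(n, #|S|) * #|[set G in gnm n m | 4 * D * #|S| <= #|edges_in _ G S|]|
    * (n * 2 ^ #|S|) <= #|gnm n m|)%N.
Proof.
move=> n1 D0 mD mN S0; set X := #|[set _ | _]|; set g := #|gnm n m|.
have := card_gnm_dense n m S (4 * D * #|S|) mN; rewrite -/X -/g.
have s0 : (0 < #|S|)%N by rewrite card_gt0.
have sn : (#|S| <= n)%N by rewrite -[X in (_ <= X)%N]card_ord max_card.
move: #|S| s0 sn X => s s0 sn X; set L := (4 * D * s)%N.
set N := 'C(n, 2); set M := 'C(s, 2) => h1.
have h2 := leq_bin_expn M L.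
have N0 : (0 < N)%N by rewrite bin_gt0.
have L0 : (0 < L)%N by rewrite /L !muln_gt0 D0.
(* Equivalent to [4 M m / (N L) <= s / (2 n)], whose left side is the base of the bound on [X / g]
   given by [h1] and [h2]. It follows from [2 m <= D n] and [(s - 1) / (n - 1) <= s / n]. *)
have h3 : (8 * M * m * n <= s * N * L)%N.
  rewrite -(leq_pmul2l (isT : 0 < 2)%N).
  have eN : (2 * N = n * n.-1)%N := mul2_bin2 n.
  have eM : (2 * M = s * s.-1)%N := mul2_bin2 s.
  have -> : (2 * (8 * M * m * n) = 4 * (2 * M) * (2 * m) * n)%N by ring.
  have -> : (2 * (s * N * L) = s * (2 * N) * (4 * D * s))%N by rewrite /L; ring.
  rewrite eN eM; apply: (@leq_trans (4 * (s * s.-1) * (D * n) * n)).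
    by rewrite leq_mul2r leq_mul2l mD !orbT.
  have -> : (4 * (s * s.-1) * (D * n) * n = (4 * s * D * n) * (s.-1 * n))%N by ring.
  have -> : (s * (n * n.-1) * (4 * D * s) = (4 * s * D * n) * (s * n.-1))%N by ring.
  by rewrite leq_mul2l; apply/orP; right; nia.
have h4 : (X * (2 * n) ^ L <= g * s ^ L)%N.
  have NL0 : (0 < (N * L) ^ L)%N by rewrite expn_gt0 muln_gt0 N0 L0.
  rewrite -(leq_pmul2r NL0).
  apply: (@leq_trans (g * (8 * M * m * n) ^ L)); last first.
    have -> : (g * s ^ L * (N * L) ^ L = g * (s * N * L) ^ L)%N by rewrite !expnMn; ring.
    by rewrite leq_mul2l leq_exp2r // h3 orbT.
  have -> : (X * (2 * n) ^ L * (N * L) ^ L = (X * N ^ L) * (L ^ L * (2 * n) ^ L))%N.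
    by rewrite !expnMn; ring.
  apply: (leq_trans (leq_mul h1 (leqnn _))).
  have -> : ('C(M, L) * (g * m ^ L) * (L ^ L * (2 * n) ^ L) =
    ('C(M, L) * L ^ L) * (g * (m * (2 * n)) ^ L))%N by rewrite !expnMn; ring.
  apply: (leq_trans (leq_mul h2 (leqnn _))).
  have -> : (8 * M * m * n = (4 * M) * (m * (2 * n)))%N by ring.
  by rewrite (expnMn (4 * M)); apply/eq_leq; ring.
(* The base [s / (2 n)] is at most 1, so the exponent [L] can be lowered to [4 s]. *)
have h5 : (X * (2 * n) ^ (4 * s) <= g * s ^ (4 * s))%N.
  have sL : (4 * s <= L)%N by rewrite /L; nia.
  have p0 : (0 < (2 * n) ^ (L - 4 * s))%N by rewrite expn_gt0; lia.
  rewrite -(leq_pmul2r p0) -mulnA -expnD subnKC //; apply: leq_trans h4 _.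
  rewrite -{1}(subnKC sL) expnD mulnA leq_mul2l; apply/orP; right.
  have [->|] := posnP (L - 4 * s); first by rewrite !expn0.
  by move=> ls; rewrite leq_exp2r //; lia.
have h6 := leq_bin_expn n s.
have c0 : (0 < 4 ^ s * n ^ s * s ^ s)%N by rewrite !muln_gt0 !expn_gt0 s0 /=; lia.
(* At most [(4 n / s) ^ s] choices of [S], times [(s / (2 n)) ^ (4 s)], make
   [(s / n) ^ (3 s) / 4 ^ s]. *)
have h7 : ('C(n, s) * X * 4 ^ s * (n ^ s) ^ 3 <= g * (s ^ s) ^ 3)%N.
  rewrite -(leq_pmul2r c0).
  have -> : ('C(n, s) * X * 4 ^ s * (n ^ s) ^ 3 * (4 ^ s * n ^ s * s ^ s) =
    ('C(n, s) * s ^ s) * (X * (2 * n) ^ (4 * s)))%N.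
    rewrite (mulnC 4 s) expnM expnMn -[4%N in RHS]/(2 * 2)%N.
    rewrite (_ : 4 ^ s = 2 ^ s * 2 ^ s)%N; last by rewrite -expnMn.
    by move: (2 ^ s)%N (n ^ s)%N (s ^ s)%N => a b c; ring.
  apply: leq_trans (leq_mul h6 h5) _; rewrite expnMn mulnC (mulnC 4 s) (expnM s).
  by apply/eq_leq; ring.
(* Only one factor [s / n] is kept: it supplies [1 / n], and its numerator is absorbed by one of the
   two factors [2 ^ s] of [4 ^ s]. *)
have h8 : ((s ^ s) ^ 3 * n <= s * (n ^ s) ^ 3)%N.
  have e x : ((x ^ s) ^ 3 = x * x ^ (s * 3).-1)%N.
    by rewrite -expnM -expnS prednK // muln_gt0 s0.
  rewrite !e -mulnA leq_mul2l; apply/orP; right.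
  rewrite mulnC leq_mul2l; apply/orP; right.
  by have [->|h] := posnP (s * 3).-1; rewrite ?expn0 // leq_exp2r.
have n30 : (0 < (n ^ s) ^ 3 * 2 ^ s)%N by rewrite muln_gt0 !expn_gt0; lia.
rewrite -(leq_pmul2r n30).
have -> : ('C(n, s) * X * (n * 2 ^ s) * ((n ^ s) ^ 3 * 2 ^ s) =
  ('C(n, s) * X * 4 ^ s * (n ^ s) ^ 3) * n)%N.
  by rewrite -[4%N]/(2 * 2)%N expnMn; ring.
apply: leq_trans (leq_mul h7 (leqnn n)) _.
rewrite -mulnA leq_mul2l; apply/orP; right; apply: leq_trans h8 _.
by rewrite mulnC leq_mul2l; apply/orP; right; apply/ltnW/ltn_expl.
Qed.

(** * The union bound over vertex sets *)

(** The sets of size [s] together contribute at most [c / 2 ^ s], and these terms sum to at most [c]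
    over [s >= 1]. *)
Lemma sum_nonempty_sets_le (R : realFieldType) n (f : {set 'I_n} -> R) (c : R) :
  0 <= c -> (forall S, S != set0 -> 'C(n, #|S|)%:R * f S <= c / (2 ^ #|S|)%:R) ->
  \sum_(S | S != set0) f S <= c.
Proof.
move=> c0 H.
rewrite (partition_big (fun S : {set 'I_n} => inord #|S| : 'I_n.+1) predT) //=.
have inordE (S : {set 'I_n}) : (inord #|S| : 'I_n.+1) = #|S| :> nat.
  by rewrite inordK // ltnS -[X in (_ <= X)%N]card_ord max_card.
have step (s : 'I_n.+1) : \sum_(S | (S != set0) && ((inord #|S| : 'I_n.+1) == s)) f S
    <= if s == ord0 then 0 else c / (2 ^ s)%:R.
  have [->|s0] := eqVneq s ord0.
    rewrite big1 // => S /andP[S0 /eqP/(congr1 (@nat_of_ord _))]; rewrite inordE => /eqP.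
    by rewrite cards_eq0 (negPf S0).
  have b0 : 0 < 'C(n, s)%:R :> R by rewrite ltr0n bin_gt0 -ltnS.
  apply: (@le_trans _ _ (\sum_(S in [set S : {set 'I_n} | #|S| == s])
      (c / (2 ^ s)%:R / 'C(n, s)%:R))); last first.
    by rewrite sumr_const card_draws card_ord -[X in X <= _]mulr_natr divfK // gt_eqF.
  rewrite [X in _ <= X](eq_bigl (fun S : {set 'I_n} =>
      (S != set0) && ((inord #|S| : 'I_n.+1) == s))); last first.
    move=> S; rewrite inE -(inj_eq (@ord_inj _)) inordE.
    have [E|] := eqVneq (#|S| : nat) s; rewrite ?andbF // andbT -card_gt0 E lt0n.
    by apply/esym; apply: contra_neq s0 => E0; apply/val_inj.
  apply: ler_sum => S /andP[S0 /eqP E]; have := H S S0.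
  by rewrite -inordE E => h; rewrite ler_pdivlMr // mulrC.
apply: le_trans (ler_sum _ (fun s _ => step s)) _.
rewrite big_ord_recl eqxx add0r /=.
have -> : \sum_(i < n) (c / (2 ^ lift ord0 i)%:R) = c * (1 - (2 ^ n)%:R^-1).
  elim: n {f H inordE step} => [|n IH]; first by rewrite big_ord0 expn0 invr1 subrr mulr0.
  rewrite big_ord_recr /=.
  have -> : \sum_(i < n) c / (2 ^ bump 0 i)%:R = c * (1 - (2 ^ n)%:R^-1).
    by rewrite -IH.
  rewrite /bump leq0n add1n expnS natrM.
  have : (2 ^ n)%:R != 0 :> R by rewrite pnatr_eq0 expn_eq0.
  by move: (_%:R) => x x0; field.
by rewrite -[X in _ <= X]mulr1; apply: ler_wpM2l => //; rewrite gerBl invr_ge0.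
Qed.

(** Union bound over the nonempty [S]. The property [P] enters only as a consequence of sparseness,
    which keeps the count apart from the threshold dimension. *)
Lemma card_gnm_dense_sum (R : realType) n m D (P : pred (sgraph 'I_n)) :
  (1 < n)%N -> (0 < D)%N -> (2 * m <= D * n)%N -> (m <= 'C(n, 2))%N ->
  (forall G, (forall S : {set 'I_n}, S != set0 -> (#|edges_in _ G S| < 4 * D * #|S|)%N) -> P G) ->
  1 - n%:R^-1 <= prob_gnm R n m P.
Proof.
move=> n1 D0 mD mN HP; rewrite /prob_gnm.
have g0 : 0 < #|gnm n m|%:R :> R by rewrite ltr0n card_gnm bin_gt0.
rewrite ler_pdivlMr //.
pose bad := [set G in gnm n m | ~~ P G].
have eg : #|gnm n m|%:R = #|[set G in gnm n m | P G]|%:R + #|bad|%:R :> R.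
  rewrite -natrD -(cardsID [set G | P G] (gnm n m)); congr (_ + _)%:R.
    by apply: eq_card => G; rewrite !inE.
  by apply: eq_card => G; rewrite !inE andbC.
suff : #|bad|%:R <= #|gnm n m|%:R / n%:R :> R.
  rewrite mulrBl mul1r (mulrC n%:R^-1) => h; lra.
pose B (S : {set 'I_n}) := [set G in gnm n m | (4 * D * #|S| <= #|edges_in _ G S|)%N].
apply: (@le_trans _ _ (\sum_(S | S != set0) #|B S|%:R)).
  rewrite -natr_sum ler_nat; apply: leq_trans (leq_card_bigcup _ _ _ _).
  apply/subset_leq_card/subsetP => G; rewrite inE => /andP[Gm nP].
  have : ~~ [forall S, (S != set0) ==> (#|edges_in _ G S| < 4 * D * #|S|)%N].
    by apply: contra nP => /forallP h; apply: HP => S S0; have /implyP := h S; apply.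
  move=> /forallPn[S]; rewrite negb_imply -leqNgt => /andP[S0 h].
  by apply/bigcupP; exists S => //; rewrite in_set Gm.
apply: sum_nonempty_sets_le => [|S S0]; first by rewrite divr_ge0.
have := card_gnm_dense_le n m D S n1 D0 mD mN S0.
have n0 : 0 < n%:R :> R by rewrite ltr0n; lia.
have p0 : 0 < (2 ^ #|S|)%:R :> R by rewrite ltr0n expn_gt0.
by rewrite -(ler_nat R) !natrM => h; rewrite !ler_pdivlMr // -mulrA (mulrC _ n%:R).
Qed.

(** * Choice of the constants *)

(** Since [1 - a <= expR (- a)], the product is at most [expR (ln x - a t)], with negative
    exponent. *)
Lemma expr_one_sub_lt1 (R : realType) (x a : R) t : 0 < a -> a <= 1 -> 0 < x ->
  ln x / a < t%:R -> (1 - a) ^+ t * x < 1.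
Proof.
move=> a0 a1 x0 ht.
have h : (1 - a) ^+ t <= expR (- (a * t%:R)).
  rewrite (_ : - (a * t%:R) = (- a) *+ t); last by rewrite mulNrn mulr_natr.
  rewrite -mulr_natl expRM_natl; apply: lerXn2r; rewrite ?nnegrE ?expR_ge0 ?subr_ge0 //.
  exact: expR_ge1Dx.
apply: le_lt_trans (ler_wpM2r (ltW x0) h) _.
rewrite -{1}(lnK x0) -expRD -[X in _ < X]expR0 ltr_expR.
by move: ht; rewrite ltr_pdivrMr // => ht; rewrite addrC subr_lt0 mulrC.
Qed.

Theorem theorem7 (R : realType) :
  exists C C' : R, 0 < C /\ 0 < C' /\
  exists n0 : nat, forall n : nat, (n0 <= n)%N ->
  forall m : nat, n%:R / 2 <= m%:R :> R -> (m <= 'C(n, 2))%N ->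
    1 - C' / n%:R <=
    prob_gnm R n m (fun G : sgraph 'I_n =>
      (dimTH R G)%:R <= C * (2 * m%:R / n%:R) * ln n%:R).
Proof.
(* Below, [t.+1 <= x + 2] with [x = 128 D ln n <= 256 d ln n]; as [d] and [ln n] are at least 1,
   this is at most [258 d ln n], and 400 leaves room. Taking [n >= 4] ensures [ln n >= 1]. *)
exists 400, 1; split=> //; split=> //; exists 4%N => n n4 m nm mN.
have n0 : 0 < n%:R :> R by rewrite ltr0n; lia.
pose D := (2 * m %/ n).+1.
have mD : (2 * m <= D * n)%N by apply: ltnW; rewrite ltn_ceil //; lia.
(* The lower bound on [m] enters here: the average degree is at least 1, hence
   [D <= d + 1 <= 2 d]. *)
have d1 : 1 <= 2 * m%:R / n%:R :> R by rewrite ler_pdivlMr //; lra.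
set d := 2 * m%:R / n%:R in d1 *.
have Dd : D%:R <= 2 * d :> R.
  have : (2 * m %/ n)%:R <= d.
    by rewrite ler_pdivlMr // -!natrM ler_nat leq_trunc_div.
  by rewrite /D -natr1; lra.
have ln1 : 1 <= ln n%:R :> R.
  rewrite -[X in X <= _]expRK ler_ln ?posrE ?expR_gt0 //.
  have h4 : 4 <= n%:R :> R by rewrite ler_nat.
  apply: le_trans h4.
  (* e <= 4, since exp (-1/2) >= 1/2 *)
  have : (1 - 2^-1) * expR 2^-1 <= expR (- 2^-1) * expR 2^-1 :> R.
    by apply: ler_wpM2r; rewrite ?expR_ge0 // expR_ge1Dx.
  rewrite -expRD addNr expR0 => h.
  have -> : expR 1 = expR 2^-1 * expR 2^-1 :> R by rewrite [in LHS](splitr 1) !mul1r expRD.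
  have := expR_gt0 (2^-1 : R); move: (expR _) h => y; nra.
rewrite div1r; apply: (card_gnm_dense_sum _ _ _ D) => //; first by lia.
move=> G /sparse_degenerate[r rinj rk].
(* The covering density [1 / (8 k)] for [k = 8 D]. At most [n ^ 2] pairs are to be covered, so any
   [t] above [ln (n ^ 2) / a] suffices. *)
pose a : R := (8 * (8 * D)%:R)^-1.
have a0 : 0 < a by rewrite invr_gt0 mulr_gt0 // ltr0n.
have a1 : a <= 1 by rewrite invf_le1 ?mulr_gt0 ?ltr0n // -natrM ler1n.
pose x := ln (n ^ 2)%:R / a.
have xE : x = 128 * D%:R * ln n%:R.
  rewrite /x /a invrK natrX lnXn // natrM -mulr_natl; ring.
have x0 : 0 <= x by rewrite xE !mulr_ge0 //; lra.
pose t := (Num.truncn x).+1.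
have xt : x < t%:R by exact: truncnS_gt.
have tx : t%:R <= x + 1 by rewrite -natr1 lerD2r truncn_le.
have le_t : (dimTH R G <= t.+1)%N.
  apply: (dimTH_le_cover R _ G r (8 * D)) => //.
  by rewrite card_ord; apply: expr_one_sub_lt1; rewrite ?ltr0n ?expn_gt0 //; lia.
apply: (@le_trans _ _ t.+1%:R); first by rewrite ler_nat.
rewrite -natr1; move: xE; set l := ln _ in ln1 *; move: (D%:R) Dd => y Dd xE.
nra.
Qed.
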